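(* A Banach space $Z$ threshold-embeds into a Hilbert space if and only if $Z$ is linearly isomorphic to a Hilbert space.
   Context: Threshold embedding: a metric space $(X,d_X)$ $K$-threshold-embeds into $(Y,d_Y)$ if there is a family of Lipschitz maps $\{\varphi_\tau:X\to Y\}_{\tau>0}$ such that for every $\tau>0$ and all $x,y\in X$, $d_X(x,y)\ge\tau$ implies $d_Y(\varphi_\tau(x),\varphi_\tau(y))\ge \|\varphi_\tau\|_{\mathrm{Lip}}\,\tau/K$; $X$ threshold-embeds into $Y$ if this holds for some $K>0$. The Banach space is viewed as a metric space with its norm metric.
   Formalization: Spaces are real, and a threshold embedding must have φ_τ non-constant (‖φ_τ‖_Lip > 0) whenever two points are at distance at least τ; otherwise constant maps would threshold-embed every Banach space and the ''only if'' part would fail. *)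

(* Defs.v *)
From Stdlib Require Import Reals.
Open Scope R_scope.

Definition vector_space_axioms (V : Type) (zero : V) (add : V -> V -> V)
  (opp : V -> V) (scal : R -> V -> V) : Prop :=
  (forall x y z, add x (add y z) = add (add x y) z) /\
  (forall x y, add x y = add y x) /\
  (forall x, add x zero = x) /\
  (forall x, add x (opp x) = zero) /\
  (forall a b x, scal a (scal b x) = scal (a * b) x) /\
  (forall x, scal 1 x = x) /\
  (forall a x y, scal a (add x y) = add (scal a x) (scal a y)) /\
  (forall a b x, scal (a + b) x = add (scal a x) (scal b x)).

Definition complete_metric (V : Type) (d : V -> V -> R) : Prop :=
  forall u : nat -> V,
    (forall eps, eps > 0 -> exists N, forall n m, (n >= N)%nat -> (m >= N)%nat ->
        d (u n) (u m) < eps) ->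
    exists l, forall eps, eps > 0 -> exists N, forall n, (n >= N)%nat -> d (u n) l < eps.

Record BanachSpace := {
  B_car :> Type;
  B_zero : B_car;
  B_add : B_car -> B_car -> B_car;
  B_opp : B_car -> B_car;
  B_scal : R -> B_car -> B_car;
  B_norm : B_car -> R;
  B_vs : vector_space_axioms B_car B_zero B_add B_opp B_scal;
  B_norm_nonneg : forall x, 0 <= B_norm x;
  B_norm_eq0 : forall x, B_norm x = 0 -> x = B_zero;
  B_norm_scal : forall a x, B_norm (B_scal a x) = Rabs a * B_norm x;
  B_norm_triangle : forall x y, B_norm (B_add x y) <= B_norm x + B_norm y;
  B_complete : complete_metric B_car (fun x y => B_norm (B_add x (B_opp y)))
}.

Definition B_dist (Z : BanachSpace) (x y : Z) : R :=
  B_norm Z (B_add Z x (B_opp Z y)).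

Record HilbertSpace := {
  H_car :> Type;
  H_zero : H_car;
  H_add : H_car -> H_car -> H_car;
  H_opp : H_car -> H_car;
  H_scal : R -> H_car -> H_car;
  H_inner : H_car -> H_car -> R;
  H_vs : vector_space_axioms H_car H_zero H_add H_opp H_scal;
  H_inner_sym : forall x y, H_inner x y = H_inner y x;
  H_inner_add : forall x y z, H_inner (H_add x y) z = H_inner x z + H_inner y z;
  H_inner_scal : forall a x y, H_inner (H_scal a x) y = a * H_inner x y;
  H_inner_pos : forall x, 0 <= H_inner x x;
  H_inner_def : forall x, H_inner x x = 0 -> x = H_zero;
  H_complete : complete_metric H_car
                 (fun x y => sqrt (H_inner (H_add x (H_opp y)) (H_add x (H_opp y))))
}.

Definition H_norm (H : HilbertSpace) (x : H) : R := sqrt (H_inner H x x).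

Definition H_dist (H : HilbertSpace) (x y : H) : R :=
  H_norm H (H_add H x (H_opp H y)).

Definition lipschitz_with {X Y : Type} (dX : X -> X -> R) (dY : Y -> Y -> R)
  (f : X -> Y) (L : R) : Prop :=
  0 <= L /\ forall x y, dY (f x) (f y) <= L * dX x y.

Definition lip_norm {X Y : Type} (dX : X -> X -> R) (dY : Y -> Y -> R)
  (f : X -> Y) (L : R) : Prop :=
  lipschitz_with dX dY f L /\
  forall L', lipschitz_with dX dY f L' -> L <= L'.

(** (X,dX) K-threshold-embeds into (Y,dY).  Non-degeneracy convention: whenever some pair of points is at distance >= tau, phi_tau
    must be non-constant (||phi_tau||_Lip > 0); otherwise constant maps would
    make the definition vacuous. *)
Definition threshold_embeds_K {X Y : Type} (dX : X -> X -> R) (dY : Y -> Y -> R)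
  (K : R) : Prop :=
  exists phi : R -> X -> Y,
    forall tau, tau > 0 ->
      exists L, lip_norm dX dY (phi tau) L /\
        ((exists x y, dX x y >= tau) -> L > 0) /\
        forall x y, dX x y >= tau -> dY (phi tau x) (phi tau y) >= L * tau / K.

Definition threshold_embeds {X Y : Type} (dX : X -> X -> R) (dY : Y -> Y -> R) : Prop :=
  exists K, K > 0 /\ threshold_embeds_K dX dY K.

Definition threshold_embeds_into_Hilbert (Z : BanachSpace) : Prop :=
  exists H : HilbertSpace, threshold_embeds (B_dist Z) (H_dist H).

Definition linear_iso (Z : BanachSpace) (H : HilbertSpace) (T : Z -> H) : Prop :=
  (forall x y, T (B_add Z x y) = H_add H (T x) (T y)) /\
  (forall a x, T (B_scal Z a x) = H_scal H a (T x)) /\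
  (forall h : H, exists z, T z = h) /\
  exists c C, c > 0 /\ C > 0 /\
    forall z, c * B_norm Z z <= H_norm H (T z) <= C * B_norm Z z.

Definition isomorphic_to_Hilbert (Z : BanachSpace) : Prop :=
  exists (H : HilbertSpace) (T : Z -> H), linear_iso Z H T.

(* Main.v *)
Require Import Defs.
From Stdlib Require Import Reals.
From Stdlib Require Import ZArith Lra Lia List Classical.
From mathcomp.classical Require boolp filter.

(** A threshold embedding at the single scale 1, normalised to be 1-Lipschitz,
    gives the kernel [k x y = |f x - f y|^2].  It satisfies [k <= |x - y|^2], is
    bounded below by [1/K^2] at distances at least 1, and satisfies Enflo's
    quadrilateral inequality.  Averaging over translations with an invariant mean
    on the abelian group [Z] yields a function [N] of [x - y] alone with the same
    bounds and with [N (x + y) + N (x - y) <= 2 N x + 2 N y].  Hence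
    [4^n N (z / 2^n)] is nondecreasing and bounded by [|z|^2]; its limit [Q]
    inherits the inequality and satisfies [Q (2 z) = 4 Q z], which turns the
    inequality into the parallelogram identity.  So [Q] is the square of a
    Hilbertian norm, and its bounds at norm 1 make it equivalent to the norm
    of [Z]. *)

(** * Ultralimits of bounded functions *)

Definition bounded {I : Type} (u : I -> R) : Prop :=
  exists C, forall i, - C <= u i <= C.

Lemma bounded_const (I : Type) (c : R) : bounded (fun _ : I => c).
Proof. exists (Rabs c); intros _; unfold Rabs; destruct (Rcase_abs c); lra. Qed.

Lemma bounded_plus (I : Type) (u v : I -> R) :
  bounded u -> bounded v -> bounded (fun i => u i + v i).
Proof.
  intros [C HC] [D HD]; exists (C + D); intros i.
  specialize (HC i); specialize (HD i); lra.
Qed.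

(** Restates the set-based ultrafilter interface in terms of plain predicates. *)
Lemma ultrafilter_rules (I : Type) (U : (I -> Prop) -> Prop) :
  filter.UltraFilter U ->
  (forall P Q : I -> Prop, (forall i, P i -> Q i) -> U P -> U Q) /\
  (forall P Q : I -> Prop, U P -> U Q -> U (fun i => P i /\ Q i)) /\
  (forall P : I -> Prop, (forall i, P i) -> U P) /\
  (forall P : I -> Prop, U P -> exists i, P i) /\
  (forall P : I -> Prop, U P \/ U (fun i => ~ P i)).
Proof.
  intros HU.
  pose proof (filter.ultra_proper (F := U)) as PU.
  pose proof (filter.filter_filter (F := U)) as FU.
  assert (HS : forall P Q : I -> Prop, (forall i, P i -> Q i) -> U P -> U Q)
    by (intros P Q; apply filter.filterS).
  repeat split.
  - exact HS.
  - intros P Q; apply filter.filterI.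
  - intros P H; apply (HS (fun _ => True)); [auto|apply filter.filterT].
  - intros P HP; apply NNPP; intro Hn.
    apply (filter.filter_not_empty U), (HS P); [|exact HP].
    intros i Hi; apply Hn; now exists i.
  - intros P; apply (filter.in_ultra_setVsetC P HU).
Qed.

(** The limit is the supremum of the levels [r] with [r <= u i] for [U]-most [i]. No level [l + eps]
    qualifies, so the ultrafilter property puts the complementary set in [U]. *)
Lemma ultrafilter_real_limit (I : Type) (U : (I -> Prop) -> Prop) (u : I -> R) :
  filter.UltraFilter U -> bounded u ->
  exists l, forall eps, eps > 0 -> U (fun i => l - eps < u i < l + eps).
Proof.
  intros HU [C HC].
  destruct (ultrafilter_rules I U HU) as (US & UI & Uall & Uex & UC).
  destruct (completeness (fun r => U (fun i => r <= u i))) as [l [Hub Hlub]].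
  - exists C; intros r Hr.
    destruct (Uex _ Hr) as [i Hi]; specialize (HC i); lra.
  - exists (- C); apply Uall; apply HC.
  - exists l; intros eps Heps.
    assert (H1 : U (fun i => l - eps < u i)).
    { apply NNPP; intro Hn.
      assert (l <= l - eps / 2); [|lra].
      apply Hlub; intros r Hr.
      destruct (Rle_or_lt r (l - eps / 2)) as [|Hlt]; [assumption|exfalso].
      apply Hn; revert Hr; apply US; intros i Hi; lra. }
    destruct (UC (fun i => l + eps <= u i)) as [H2|H2].
    + specialize (Hub _ H2); lra.
    + generalize (UI _ _ H1 H2); apply US; intros i Hi; lra.
Qed.

(** Finitely many sets of [U] share an index, so a failure of additivity or monotonicity would
    already be contradicted by numbers at a single index. *)
Lemma ultralimit (I : Type) (U : (I -> Prop) -> Prop) :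
  filter.UltraFilter U ->
  exists lim : (I -> R) -> R,
    (forall u v, bounded u -> bounded v -> lim (fun i => u i + v i) = lim u + lim v) /\
    (forall u v, bounded u -> bounded v -> U (fun i => u i <= v i) -> lim u <= lim v) /\
    (forall c, lim (fun _ => c) = c).
Proof.
  intros HU.
  destruct (ultrafilter_rules I U HU) as (US & UI & Uall & Uex & UC).
  destruct (@boolp.choice (I -> R) R
    (fun u l => bounded u -> forall eps, eps > 0 -> U (fun i => l - eps < u i < l + eps)))
    as [lim Hlim].
  { intros u; destruct (classic (bounded u)) as [Hu|Hu].
    - destruct (ultrafilter_real_limit I U u HU Hu) as [l Hl]; exists l; auto.
    - exists 0; intros; contradiction. }
  exists lim; repeat split.
  - intros u v Hu Hv; apply NNPP; intro Hn.
    pose proof (bounded_plus I u v Hu Hv) as Huv.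
    (* A third of the supposed gap: the three approximation errors at a common index add up to less
       than the gap. *)
    pose (eps := Rabs (lim (fun i => u i + v i) - (lim u + lim v)) / 3).
    assert (Heps : eps > 0).
    { assert (Rabs (lim (fun i => u i + v i) - (lim u + lim v)) > 0)
        by (apply Rabs_pos_lt; lra).
      unfold eps; lra. }
    destruct (Uex _ (UI _ _ (Hlim _ Huv _ Heps) (UI _ _ (Hlim _ Hu _ Heps) (Hlim _ Hv _ Heps))))
      as [i Hi].
    unfold eps, Rabs in Hi; destruct (Rcase_abs _); lra.
  - intros u v Hu Hv H; apply Rnot_lt_le; intro Hlt.
    assert (Heps : (lim u - lim v) / 2 > 0) by lra.
    destruct (Uex _ (UI _ _ H (UI _ _ (Hlim _ Hu _ Heps) (Hlim _ Hv _ Heps)))) as [i Hi].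
    lra.
  - intros c; apply NNPP; intro Hn.
    assert (Heps : Rabs (lim (fun _ => c) - c) > 0) by (apply Rabs_pos_lt; lra).
    destruct (Uex _ (Hlim _ (bounded_const I c) _ Heps)) as [i Hi].
    unfold Rabs in Hi; destruct (Rcase_abs _); lra.
Qed.

(** * Invariant means *)

(** [averaging_translate] is equivariance, not invariance; invariance appears only in the limit of
    growing boxes. *)
Record averaging {G : Type} (op : G -> G -> G) (A : (G -> R) -> G -> R) : Prop := {
  averaging_add : forall f g x, A (fun y => f y + g y) x = A f x + A g x;
  averaging_le : forall f g, (forall y, f y <= g y) -> forall x, A f x <= A g x;
  averaging_const : forall c x, A (fun _ => c) x = c;
  averaging_translate : forall a f x, A (fun y => f (op a y)) x = A f (op a x)
}.

(** [sum_f_R0] has [n + 1] terms, so the divisor is [INR (S n)] and never vanishes. *)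
Definition orbit_average {G : Type} (op : G -> G -> G) (n : nat) (a : G)
  (f : G -> R) (x : G) : R :=
  sum_f_R0 (fun k => f (Nat.iter k (op a) x)) n / INR (S n).

Fixpoint box_average {G : Type} (op : G -> G -> G) (n : nat) (s : list G)
  (f : G -> R) : G -> R :=
  match s with
  | nil => f
  | a :: s' => box_average op n s' (orbit_average op n a f)
  end.

Lemma INR_S_pos (n : nat) : 0 < INR (S n).
Proof. apply lt_0_INR; lia. Qed.

Lemma orbit_average_averaging (G : Type) (op : G -> G -> G) (n : nat) (a : G) :
  (forall b c x, op b (op c x) = op c (op b x)) -> averaging op (orbit_average op n a).
Proof.
  intros comm; pose proof (INR_S_pos n) as Hn; unfold orbit_average; split.
  - intros f g x; rewrite plus_sum; field; lra.
  - intros f g H x; apply Rmult_le_compat_r.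
    + left; now apply Rinv_0_lt_compat.
    + now apply sum_Rle.
  - intros c x; rewrite sum_cte; field; lra.
  - intros b f x; f_equal; apply sum_eq; intros k _; f_equal.
    induction k as [|k IH]; [reflexivity|simpl; now rewrite comm, IH].
Qed.

Lemma box_average_averaging (G : Type) (op : G -> G -> G) (n : nat) (s : list G) :
  (forall b c x, op b (op c x) = op c (op b x)) -> averaging op (box_average op n s).
Proof.
  intros comm; induction s as [|a s [Hadd Hle Hconst Htr]]; [split; auto|].
  destruct (orbit_average_averaging G op n a comm) as [Oadd Ole Oconst Otr].
  (* Extensionality follows from monotonicity applied in both directions. *)
  assert (Hext : forall f g, (forall y, f y = g y) -> forall x,
            box_average op n s f x = box_average op n s g x).
  { intros f g H x; apply Rle_antisym; apply Hle; intros; rewrite H; lra. }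
  simpl; split.
  - intros f g x; rewrite <- Hadd; apply Hext; auto.
  - intros; apply Hle; intros; now apply Ole.
  - intros c x; transitivity (box_average op n s (fun _ => c) x); [apply Hext|]; auto.
  - intros b f x; rewrite <- Htr; apply Hext; auto.
Qed.

Lemma averaging_bound (G : Type) (op : G -> G -> G) (A : (G -> R) -> G -> R)
  (f : G -> R) (C : R) :
  averaging op A -> (forall x, - C <= f x <= C) -> forall x, - C <= A f x <= C.
Proof.
  intros [_ Hle Hconst _] HC x; split.
  - rewrite <- (Hconst (- C) x); apply Hle; intros; apply HC.
  - rewrite <- (Hconst C x); apply Hle; intros; apply HC.
Qed.

(** Shifting by [a] changes only the two end terms of the orbit average in direction [a], which
    costs at most [2 * C / INR (S n)]. Averaging in the other directions preserves this bound. *)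
Lemma box_average_almost_invariant (G : Type) (op : G -> G -> G) (n : nat)
  (s : list G) (a : G) (C : R) :
  (forall b c x, op b (op c x) = op c (op b x)) -> In a s ->
  forall f : G -> R, (forall x, - C <= f x <= C) -> forall x,
  - (2 * C / INR (S n)) <= box_average op n s (fun y => f (op a y)) x - box_average op n s f x
    <= 2 * C / INR (S n).
Proof.
  intros comm; induction s as [|b s IH]; [intros []|].
  intros Hin f HC x; cbn [box_average].
  destruct (box_average_averaging G op n s comm) as [Hadd Hle Hconst Htr].
  pose proof (INR_S_pos n) as Hn.
  destruct (classic (b = a)) as [->|Hba].
  - assert (Hd : forall y, - (2 * C / INR (S n)) <=
        orbit_average op n a (fun z => f (op a z)) y - orbit_average op n a f y
        <= 2 * C / INR (S n)).
    { intros y; unfold orbit_average.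
      rewrite <- Rdiv_minus_distr.
      replace (sum_f_R0 (fun k => f (op a (Nat.iter k (op a) y))) n
               - sum_f_R0 (fun k => f (Nat.iter k (op a) y)) n)
        with (f (Nat.iter (S n) (op a) y) - f y).
      2:{ clear - n; induction n as [|n IH]; simpl in *; lra. }
      pose proof (HC (Nat.iter (S n) (op a) y)); pose proof (HC y).
      rewrite <- Rdiv_opp_l.
      split; apply Rmult_le_compat_r; try (left; now apply Rinv_0_lt_compat); lra. }
    assert (H1 := Hle (orbit_average op n a (fun z => f (op a z)))
       (fun y => orbit_average op n a f y + 2 * C / INR (S n))
       ltac:(intros y; specialize (Hd y); lra) x).
    assert (H2 := Hle (orbit_average op n a f)
       (fun y => orbit_average op n a (fun z => f (op a z)) y + 2 * C / INR (S n))
       ltac:(intros y; specialize (Hd y); lra) x).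
    rewrite Hadd, Hconst in H1, H2; lra.
  (* Translation by [a] passes through the average in direction [b], so the induction hypothesis
     applies to [orbit_average op n b f], which keeps the bound [C]. *)
  - destruct Hin as [|Hin]; [contradiction|].
    pose proof (orbit_average_averaging G op n b comm) as Ob.
    specialize (IH Hin (orbit_average op n b f) (averaging_bound G op _ f C Ob HC) x).
    replace (box_average op n s (orbit_average op n b (fun y => f (op a y))) x)
      with (box_average op n s (fun y => orbit_average op n b f (op a y)) x); [exact IH|].
    apply Rle_antisym; apply Hle; intros y;
      rewrite (averaging_translate op _ Ob a f y); lra.
Qed.

Definition invariant_mean {G : Type} (op : G -> G -> G) (M : (G -> R) -> R) : Prop :=
  (forall f g, bounded f -> bounded g -> M (fun x => f x + g x) = M f + M g) /\
  (forall f g, bounded f -> bounded g -> (forall x, f x <= g x) -> M f <= M g) /\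
  (forall c, M (fun _ => c) = c) /\
  (forall a f, bounded f -> M (fun x => f (op a x)) = M f).

(* The mean is an ultralimit of averages over the boxes
   [{x0 + k_1 a_1 + ... + k_m a_m | 0 <= k_i <= n}], as [n] and the list of
   the [a_i] grow. *)
Lemma invariant_mean_exists (G : Type) (op : G -> G -> G) (x0 : G) :
  (forall b c x, op b (op c x) = op c (op b x)) ->
  exists M, invariant_mean op M.
Proof.
  intros comm.
  (* The filter of tails of the directed set of pairs (directions, side length); an ultrafilter
     refining it makes every fixed direction eventually present and the sides eventually long. *)
  pose (F := fun P : list G * nat -> Prop => exists s m, forall s' n,
               incl s s' -> (m <= n)%nat -> P (s', n)).
  assert (PF : filter.ProperFilter F).
  { split.
    - intros (s & m & H); exact (H s m (incl_refl s) (le_n m)).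
    - split.
      + exists nil, 0%nat; intros; exact Logic.I.
      + intros P Q (s & m & HP) (s' & m' & HQ).
        exists (s ++ s'), (max m m'); intros t n Ht Hn; split.
        * apply HP; [|lia].
          intros y Hy; apply Ht, in_or_app; now left.
        * apply HQ; [|lia].
          intros y Hy; apply Ht, in_or_app; now right.
      + intros P Q HPQ (s & m & HP); exists s, m; intros; apply HPQ; auto. }
  destruct (filter.ultraFilterLemma PF) as [U [HU HFU]].
  destruct (ultrafilter_rules _ U HU) as (US & _ & Uall & _ & _).
  destruct (ultralimit _ U HU) as (lim & Ladd & Lle & Lconst).
  assert (Hav : forall i : list G * nat, averaging op (box_average op (snd i) (fst i)))
    by (intros; now apply box_average_averaging).
  assert (Hb : forall f, bounded f ->
            bounded (fun i : list G * nat => box_average op (snd i) (fst i) f x0)).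
  { intros f [C HC]; exists C; intros i; now apply (averaging_bound _ op). }
  assert (Hext : forall u v : list G * nat -> R, bounded u -> bounded v ->
            (forall i, u i = v i) -> lim u = lim v).
  { intros u v Hu Hv H; apply Rle_antisym; apply Lle; auto; apply Uall; intros;
      rewrite H; lra. }
  exists (fun f => lim (fun i => box_average op (snd i) (fst i) f x0)).
  repeat split.
  - intros f g Hf Hg; rewrite <- Ladd; auto.
    apply Hext; auto using bounded_plus.
    intros i; apply (averaging_add op _ (Hav i)).
  - intros f g Hf Hg H; apply Lle; auto.
    apply Uall; intros i; now apply (averaging_le op _ (Hav i)).
  - intros c; transitivity (lim (fun _ => c)); [|apply Lconst].
    apply Hext; auto using bounded_const.
    intros i; apply (averaging_const op _ (Hav i)).
  - intros a f Hf.
    assert (Hfa : bounded (fun x => f (op a x))) by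
      (destruct Hf as [C HC]; exists C; auto).
    assert (Hnear : forall eps, eps > 0 -> U (fun i =>
       - eps <= box_average op (snd i) (fst i) (fun x => f (op a x)) x0
                - box_average op (snd i) (fst i) f x0 <= eps)).
    { intros eps Heps; apply HFU.
      destruct Hf as [C HC].
      (* Once [a] is among the directions and the side exceeds [2 * C / eps], the almost-invariance
         error is at most [eps]. *)
      destruct (INR_unbounded (2 * C / eps)) as [m Hm].
      exists (a :: nil), m; intros s n Hs Hn; cbn [fst snd].
      pose proof (box_average_almost_invariant G op n s a C comm
                    (Hs a (or_introl eq_refl)) f HC x0) as H.
      assert (2 * C / INR (S n) <= eps); [|lra].
      pose proof (INR_S_pos n).
      apply Rmult_le_reg_r with (INR (S n)); [assumption|].
      replace (2 * C / INR (S n) * INR (S n)) with (2 * C / eps * eps) by (field; lra).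
      rewrite (Rmult_comm eps); apply Rmult_le_compat_r; [lra|].
      apply Rle_trans with (INR m); [lra|apply le_INR; lia]. }
    apply Rle_antisym; apply le_epsilon; intros eps Heps;
      rewrite <- (Lconst eps), <- Ladd by auto using bounded_const;
      apply Lle; auto using bounded_const, bounded_plus;
      generalize (Hnear eps Heps); apply US; intros i Hi; lra.
Qed.

(** * Banach space arithmetic *)

Lemma B_add_assoc (Z : BanachSpace) (x y z : Z) :
  B_add Z x (B_add Z y z) = B_add Z (B_add Z x y) z.
Proof. apply (B_vs Z). Qed.

Lemma B_add_comm (Z : BanachSpace) (x y : Z) : B_add Z x y = B_add Z y x.
Proof. apply (B_vs Z). Qed.

Lemma B_add_zero (Z : BanachSpace) (x : Z) : B_add Z x (B_zero Z) = x.
Proof. apply (B_vs Z). Qed.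

Lemma B_add_opp (Z : BanachSpace) (x : Z) : B_add Z x (B_opp Z x) = B_zero Z.
Proof. apply (B_vs Z). Qed.

Lemma B_scal_scal (Z : BanachSpace) a b (x : Z) :
  B_scal Z a (B_scal Z b x) = B_scal Z (a * b) x.
Proof. apply (B_vs Z). Qed.

Lemma B_scal_one (Z : BanachSpace) (x : Z) : B_scal Z 1 x = x.
Proof. apply (B_vs Z). Qed.

Lemma B_scal_add (Z : BanachSpace) a (x y : Z) :
  B_scal Z a (B_add Z x y) = B_add Z (B_scal Z a x) (B_scal Z a y).
Proof. apply (B_vs Z). Qed.

Lemma B_scal_plus (Z : BanachSpace) a b (x : Z) :
  B_scal Z (a + b) x = B_add Z (B_scal Z a x) (B_scal Z b x).
Proof. apply (B_vs Z). Qed.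

Lemma B_add_left_comm (Z : BanachSpace) (x y z : Z) :
  B_add Z x (B_add Z y z) = B_add Z y (B_add Z x z).
Proof. now rewrite !B_add_assoc, (B_add_comm Z x y). Qed.

Lemma B_add_right_comm (Z : BanachSpace) (x y z : Z) :
  B_add Z (B_add Z x y) z = B_add Z (B_add Z x z) y.
Proof. now rewrite <- !B_add_assoc, (B_add_comm Z y z). Qed.

Lemma B_add_addK (Z : BanachSpace) (x y : Z) : B_add Z (B_add Z x y) (B_opp Z y) = x.
Proof. now rewrite <- B_add_assoc, B_add_opp, B_add_zero. Qed.

Lemma B_opp_unique (Z : BanachSpace) (x y : Z) : B_add Z x y = B_zero Z -> y = B_opp Z x.
Proof.
  intros H; rewrite <- (B_add_addK Z y x), (B_add_comm Z y x), H.
  now rewrite B_add_comm, B_add_zero.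
Qed.

Lemma B_scal_zero (Z : BanachSpace) (x : Z) : B_scal Z 0 x = B_zero Z.
Proof.
  rewrite <- (B_add_addK Z (B_scal Z 0 x) (B_scal Z 0 x)), <- B_scal_plus.
  now rewrite Rplus_0_r, B_add_opp.
Qed.

Lemma B_opp_scal (Z : BanachSpace) (x : Z) : B_opp Z x = B_scal Z (- 1) x.
Proof.
  symmetry; apply B_opp_unique.
  rewrite <- (B_scal_one Z x) at 1; rewrite <- B_scal_plus.
  replace (1 + -1) with 0 by lra; apply B_scal_zero.
Qed.

Lemma B_opp_add (Z : BanachSpace) (x y : Z) :
  B_opp Z (B_add Z x y) = B_add Z (B_opp Z x) (B_opp Z y).
Proof. now rewrite !B_opp_scal, B_scal_add. Qed.

Lemma B_opp_opp (Z : BanachSpace) (x : Z) : B_opp Z (B_opp Z x) = x.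
Proof.
  rewrite !B_opp_scal, B_scal_scal; replace (-1 * -1) with 1 by lra; apply B_scal_one.
Qed.

Lemma B_norm_opp (Z : BanachSpace) (x : Z) : B_norm Z (B_opp Z x) = B_norm Z x.
Proof. rewrite B_opp_scal, B_norm_scal, Rabs_left by lra; lra. Qed.

Lemma B_norm_zero (Z : BanachSpace) : B_norm Z (B_zero Z) = 0.
Proof. rewrite <- (B_scal_zero Z (B_zero Z)), B_norm_scal, Rabs_R0; lra. Qed.

Lemma B_dist_add (Z : BanachSpace) (b z : Z) : B_dist Z b (B_add Z b z) = B_norm Z z.
Proof.
  unfold B_dist; rewrite B_opp_add, B_add_assoc, B_add_opp, B_add_comm, B_add_zero.
  apply B_norm_opp.
Qed.

(** * Translation-invariant kernels *)

(** [N z] is the mean of [k b (b + z)] over the base point [b]. The bounds survive because the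
    distance from [b] to [b + z] does not depend on [b]; the quadrilateral inequality is averaged
    over parallelograms. *)
Lemma translation_invariant_kernel (Z : BanachSpace) (k : Z -> Z -> R) (c : R) :
  (forall x y, 0 <= k x y <= (B_dist Z x y)²) ->
  (forall x y, B_dist Z x y >= 1 -> c <= k x y) ->
  (forall p q r s, k p r + k s q <= k p q + k q r + k s r + k p s) ->
  exists N : Z -> R,
    (forall z, 0 <= N z <= (B_norm Z z)²) /\
    (forall z, B_norm Z z >= 1 -> c <= N z) /\
    (forall x y, N (B_add Z x y) + N (B_add Z x (B_opp Z y)) <= 2 * N x + 2 * N y).
Proof.
  intros Hk Hc Hq.
  destruct (invariant_mean_exists Z (B_add Z) (B_zero Z) (B_add_left_comm Z))
    as (M & Madd & Mle & Mconst & Minv).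
  set (f := fun z b => k b (B_add Z b z)).
  assert (Hf : forall z b, 0 <= f z b <= (B_norm Z z)²).
  { intros z b; rewrite <- (B_dist_add Z b z); apply Hk. }
  assert (Hb : forall z, bounded (f z)).
  { intros z; exists ((B_norm Z z)²); intros b; specialize (Hf z b); lra. }
  assert (Hbt : forall z a, bounded (fun b => f z (B_add Z a b))).
  { intros z a; destruct (Hb z) as [C HC]; exists C; auto. }
  exists (fun z => M (f z)); split; [|split].
  - intros z; rewrite <- (Mconst 0), <- (Mconst ((B_norm Z z)²)).
    split; apply Mle; auto using bounded_const; intros b; apply Hf.
  - intros z Hz; rewrite <- (Mconst c).
    apply Mle; auto using bounded_const; intros b; apply Hc.
    now rewrite B_dist_add.
  - intros x y.
    (* Invariance moves base points: the diagonal [x - y] to [y + b], one side [y] to [x + b], one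
       side [x] to [y + b]. All six terms then belong to one parallelogram. *)
    rewrite <- (Minv y (f (B_add Z x (B_opp Z y)))) by auto.
    replace (2 * M (f x) + 2 * M (f y)) with (M (f x) + M (f y) + M (f x) + M (f y)) by lra.
    rewrite <- (Minv x (f y)) at 1 by auto.
    rewrite <- (Minv y (f x)) at 2 by auto.
    rewrite <- !Madd by auto using bounded_plus.
    apply Mle; auto 6 using bounded_plus.
    intros b; unfold f.
    (* the parallelogram [b, x + b, x + b + y, y + b] *)
    specialize (Hq b (B_add Z x b) (B_add Z (B_add Z x b) y) (B_add Z y b)).
    replace (B_add Z (B_add Z y b) (B_add Z x (B_opp Z y))) with (B_add Z x b).
    2:{ rewrite (B_add_left_comm Z (B_add Z y b)), (B_add_comm Z y b), B_add_addK.
        reflexivity. }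
    replace (B_add Z b (B_add Z x y)) with (B_add Z (B_add Z x b) y)
      by (now rewrite B_add_assoc, (B_add_comm Z b x)).
    replace (B_add Z (B_add Z y b) x) with (B_add Z (B_add Z x b) y)
      by (now rewrite (B_add_comm Z (B_add Z y b) x), (B_add_comm Z y b), B_add_assoc).
    rewrite (B_add_comm Z b x), (B_add_comm Z b y); lra.
Qed.

(** * The quadratic form at infinitesimal scale *)

(** Taking [x = y = w] in the inequality, with [0 <= N 0], gives [N (2 w) <= 4 N w]; this makes the
    rescaled sequence grow. Its term at [n = 0] is [N z], so [Q] dominates [N] and inherits the
    lower bound. *)
Lemma quadratic_form_exists (Z : BanachSpace) (N : Z -> R) (c : R) :
  (forall z, 0 <= N z <= (B_norm Z z)²) ->
  (forall z, B_norm Z z >= 1 -> c <= N z) ->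
  (forall x y, N (B_add Z x y) + N (B_add Z x (B_opp Z y)) <= 2 * N x + 2 * N y) ->
  exists Q : Z -> R,
    (forall z, 0 <= Q z <= (B_norm Z z)²) /\
    (forall z, B_norm Z z >= 1 -> c <= Q z) /\
    (forall x y, Q (B_add Z x y) + Q (B_add Z x (B_opp Z y)) = 2 * Q x + 2 * Q y).
Proof.
  intros HN Hc Hpar.
  set (a := fun z n => 4 ^ n * N (B_scal Z (/ 2 ^ n) z)).
  assert (Hhalf : forall n z, B_add Z (B_scal Z (/ 2 ^ S n) z) (B_scal Z (/ 2 ^ S n) z)
                    = B_scal Z (/ 2 ^ n) z).
  { intros n z; rewrite <- B_scal_plus; f_equal; simpl; field.
    apply pow_nonzero; lra. }
  assert (H4 : forall n, 0 < 4 ^ n) by (intros; apply pow_lt; lra).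
  assert (Hgrow : forall z, Un_growing (a z)).
  { intros z n; unfold a; rewrite <- Hhalf.
    set (w := B_scal Z (/ 2 ^ S n) z).
    pose proof (Hpar w w) as H; rewrite B_add_opp in H.
    pose proof (proj1 (HN (B_zero Z))).
    replace (4 ^ S n * N w) with (4 ^ n * (4 * N w)) by (simpl; lra).
    apply Rmult_le_compat_l; [left; apply H4|lra]. }
  assert (Hbound : forall z n, a z n <= (B_norm Z z)²).
  { intros z n; unfold a.
    apply Rle_trans with (4 ^ n * (B_norm Z (B_scal Z (/ 2 ^ n) z))²).
    - apply Rmult_le_compat_l; [left; apply H4|apply HN].
    - rewrite B_norm_scal, Rsqr_mult, <- Rsqr_abs.
      replace (4 ^ n) with ((2 ^ n)²).
      + right; unfold Rsqr; field; apply pow_nonzero; lra.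
      + unfold Rsqr; rewrite <- Rpow_mult_distr; f_equal; lra. }
  assert (Hub : forall z, has_ub (a z)).
  { intros z; exists ((B_norm Z z)²); intros r [n ->]; apply Hbound. }
  set (Q := fun z => proj1_sig (growing_cv (a z) (Hgrow z) (Hub z))).
  assert (HQ : forall z, Un_cv (a z) (Q z)) by (intros z; apply proj2_sig).
  assert (HaQ : forall z n, a z n <= Q z) by (intros; apply growing_ineq; auto).
  assert (HNQ : forall z, N z <= Q z).
  { intros z; specialize (HaQ z 0%nat); unfold a in HaQ; simpl in HaQ.
    rewrite Rinv_1, B_scal_one in HaQ; lra. }
  assert (Hle : forall x y,
      Q (B_add Z x y) + Q (B_add Z x (B_opp Z y)) <= 2 * Q x + 2 * Q y).
  { intros x y.
    apply Rle_cv_lim with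
      (Un := fun n => a (B_add Z x y) n + a (B_add Z x (B_opp Z y)) n)
      (Vn := fun n => (a x n + a x n) + (a y n + a y n)).
    - intros n; unfold a; rewrite B_opp_scal, !B_scal_add, B_scal_scal.
      rewrite (Rmult_comm _ (-1)), <- B_scal_scal, <- B_opp_scal.
      specialize (Hpar (B_scal Z (/ 2 ^ n) x) (B_scal Z (/ 2 ^ n) y)).
      apply (Rmult_le_compat_l (4 ^ n)) in Hpar; [lra|left; apply H4].
    - now apply CV_plus.
    - replace (2 * Q x + 2 * Q y) with ((Q x + Q x) + (Q y + Q y)) by lra.
      repeat apply CV_plus; auto. }
  (* The term of index [S n] at [2 z] is four times the term of index [n] at [z]. *)
  assert (Hdouble : forall z, 4 * Q z <= Q (B_add Z z z)).
  { intros z; cut (Q z <= Q (B_add Z z z) / 4); [lra|].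
    apply Rle_cv_lim with (Un := a z) (Vn := fun _ => Q (B_add Z z z) / 4); auto.
    - intros n; specialize (HaQ (B_add Z z z) (S n)); unfold a in *.
      rewrite B_scal_add, Hhalf in HaQ; simpl in HaQ; lra.
    - intros eps Heps; exists 0%nat; intros n _; rewrite Rdist_eq; lra. }
  exists Q; split; [|split].
  - intros z; split.
    + apply Rle_trans with (N z); [apply HN|apply HNQ].
    + apply Rle_cv_lim with (Un := a z) (Vn := fun _ => (B_norm Z z)²); auto.
      intros eps Heps; exists 0%nat; intros n _; rewrite Rdist_eq; lra.
  - intros z Hz; apply Rle_trans with (N z); auto.
  - intros x y; apply Rle_antisym; [apply Hle|].
    (* the inequality for the sides [x + y] and [x - y], whose diagonals are [2x] and [2y] *)
    specialize (Hle (B_add Z x y) (B_add Z x (B_opp Z y))).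
    replace (B_add Z (B_add Z x y) (B_add Z x (B_opp Z y))) with (B_add Z x x) in Hle
      by (now rewrite (B_add_left_comm Z (B_add Z x y) x), B_add_addK).
    replace (B_add Z (B_add Z x y) (B_opp Z (B_add Z x (B_opp Z y)))) with (B_add Z y y) in Hle
      by (now rewrite B_opp_add, B_opp_opp, B_add_assoc, (B_add_comm Z x y), B_add_addK).
    pose proof (Hdouble x); pose proof (Hdouble y); lra.
Qed.

(** * The Jordan-von Neumann theorem *)

(** The deviation [g t = f t - t * f 1] is additive and vanishes on the integers, hence is bounded
    on all of [R]; [g (n t) = n g t] for every natural [n] then forces [g = 0]. *)
Lemma additive_bounded_linear (f : R -> R) (C : R) :
  (forall s t, f (s + t) = f s + f t) ->
  (forall t, 0 <= t <= 1 -> - C <= f t <= C) ->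
  forall t, f t = t * f 1.
Proof.
  intros Hadd HC.
  assert (H0 : f 0 = 0) by (pose proof (Hadd 0 0) as H; rewrite Rplus_0_r in H; lra).
  assert (Hopp : forall t, f (- t) = - f t).
  { intros t; pose proof (Hadd t (- t)) as H; rewrite Rplus_opp_r in H; lra. }
  assert (Hnat : forall n t, f (INR n * t) = INR n * f t).
  { intros n t; induction n as [|n IH].
    - simpl; now rewrite !Rmult_0_l.
    - rewrite S_INR, !Rmult_plus_distr_r, !Rmult_1_l, Hadd; lra. }
  assert (Hint : forall z, f (IZR z) = IZR z * f 1).
  { intros z; destruct (Z.le_ge_cases 0 z) as [Hz|Hz].
    - rewrite <- (Z2Nat.id z Hz), <- INR_IZR_INZ, <- Hnat; f_equal; lra.
    - replace z with (- Z.of_nat (Z.to_nat (- z)))%Z by lia.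
      rewrite opp_IZR, Hopp, <- INR_IZR_INZ, Ropp_mult_distr_l_reverse, <- Hnat.
      now rewrite Rmult_1_r. }
  set (g := fun t => f t - t * f 1).
  assert (Hg : forall t, - (2 * C) <= g t <= 2 * C).
  { intros t; unfold g.
    (* The integer part cancels, leaving [f s - s * f 1] with [s] the fractional part; each term is
       at most [C] in absolute value. *)
    replace t with (IZR (Int_part t) + frac_part t) by (unfold frac_part; lra).
    rewrite Hadd, Hint.
    destruct (base_fp t) as [Hf1 Hf2].
    pose proof (HC 1 ltac:(lra)); pose proof (HC (frac_part t) ltac:(lra)).
    nra. }
  intros t; apply NNPP; intro Hn.
  assert (Hpos : 0 < Rabs (g t)) by (apply Rabs_pos_lt; unfold g; lra).
  destruct (INR_unbounded (2 * C / Rabs (g t))) as [n Hn'].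
  apply (Rmult_lt_compat_r (Rabs (g t))) in Hn'; [|assumption].
  replace (2 * C / Rabs (g t) * Rabs (g t)) with (2 * C) in Hn' by (field; lra).
  pose proof (Hg (INR n * t)) as H.
  assert (Hgn : g (INR n * t) = INR n * g t) by (unfold g; rewrite Hnat; lra).
  rewrite Hgn in H.
  unfold Rabs in *; destruct (Rcase_abs (g t)); lra.
Qed.

(** Polarisation. Additivity is algebra; real homogeneity follows because [t |-> B (t x) y] is
    additive and bounded on [[0, 1]]. *)
Lemma jordan_von_neumann (Z : BanachSpace) (Q : Z -> R) :
  (forall z, 0 <= Q z <= (B_norm Z z)²) ->
  (forall x y, Q (B_add Z x y) + Q (B_add Z x (B_opp Z y)) = 2 * Q x + 2 * Q y) ->
  exists B : Z -> Z -> R,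
    (forall x y, B x y = B y x) /\
    (forall x y z, B (B_add Z x y) z = B x z + B y z) /\
    (forall a x y, B (B_scal Z a x) y = a * B x y) /\
    (forall x, B x x = Q x).
Proof.
  intros HQ Hpar.
  set (B := fun x y => (Q (B_add Z x y) - Q x - Q y) / 2).
  assert (Hsym : forall x y, B x y = B y x).
  { intros x y; unfold B; rewrite (B_add_comm Z x y); lra. }
  assert (Hadd : forall x y z, B (B_add Z x y) z = B x z + B y z).
  { intros x y z; unfold B.
    (* [P1 - P2 + P3] cancels [Q (x + z - y)] and [Q (x + y - z)]; [P4] eliminates [Q (z - y)]. What
       remains expresses [Q (x + y + z)] through pairwise sums and single vectors. *)
    pose proof (Hpar (B_add Z x z) y) as P1.
    pose proof (Hpar x (B_add Z z (B_opp Z y))) as P2.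
    pose proof (Hpar (B_add Z x y) z) as P3.
    pose proof (Hpar z y) as P4.
    rewrite B_opp_add, B_opp_opp, !B_add_assoc, (B_add_right_comm Z x (B_opp Z z) y) in P2.
    rewrite (B_add_right_comm Z x z y) in P1.
    rewrite (B_add_comm Z z y) in P4.
    lra. }
  exists B; split; [exact Hsym|split; [exact Hadd|split]].
  - intros a x y.
    rewrite <- (B_scal_one Z x) at 2.
    (* For [t] in [[0, 1]] this constant bounds [Q (t x + y)] by the triangle inequality, and also
       [Q (t x) + Q y]. *)
    apply (additive_bounded_linear (fun t => B (B_scal Z t x) y)
             ((B_norm Z x + B_norm Z y)²)).
    + intros s t; rewrite B_scal_plus; apply Hadd.
    + intros t Ht; unfold B.
      pose proof (HQ (B_scal Z t x)) as H1.
      pose proof (HQ y) as H2.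
      pose proof (HQ (B_add Z (B_scal Z t x) y)) as H3.
      pose proof (B_norm_triangle Z (B_scal Z t x) y) as H4.
      rewrite B_norm_scal, Rabs_pos_eq in H1, H4 by lra.
      pose proof (B_norm_nonneg Z x).
      pose proof (B_norm_nonneg Z y).
      pose proof (B_norm_nonneg Z (B_add Z (B_scal Z t x) y)).
      assert (t * B_norm Z x <= B_norm Z x) by nra.
      assert (0 <= t * B_norm Z x) by nra.
      unfold Rsqr in *; nra.
  - intros x; unfold B.
    pose proof (Hpar x x) as H; rewrite B_add_opp in H.
    assert (Q (B_zero Z) = 0).
    { pose proof (HQ (B_zero Z)) as H0; rewrite B_norm_zero in H0.
      unfold Rsqr in H0; lra. }
    lra.
Qed.

(** By homogeneity the lower bound on unit vectors makes the form's norm equivalent to that of [Z],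
    so completeness transfers. The Hilbert space is [Z] itself with inner product [B], and the
    isomorphism is the identity. *)
Lemma inner_product_isomorphic (Z : BanachSpace) (B : Z -> Z -> R) (c : R) :
  c > 0 ->
  (forall x y, B x y = B y x) ->
  (forall x y z, B (B_add Z x y) z = B x z + B y z) ->
  (forall a x y, B (B_scal Z a x) y = a * B x y) ->
  (forall x, 0 <= B x x <= (B_norm Z x)²) ->
  (forall x, B_norm Z x >= 1 -> c <= B x x) ->
  isomorphic_to_Hilbert Z.
Proof.
  intros Hc Hsym Hadd Hscal Hup Hlow.
  assert (Hsc : 0 < sqrt c) by (apply sqrt_lt_R0; lra).
  assert (Hlower : forall z, sqrt c * B_norm Z z <= sqrt (B z z)).
  { intros z; pose proof (B_norm_nonneg Z z) as H.
    destruct (Req_dec (B_norm Z z) 0) as [H0|H0].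
    - rewrite H0, Rmult_0_r; apply sqrt_pos.
    - pose proof (Hlow (B_scal Z (/ B_norm Z z) z)) as H1.
      rewrite B_norm_scal, Rabs_pos_eq, Rinv_l in H1
        by (auto; left; apply Rinv_0_lt_compat; lra).
      specialize (H1 ltac:(lra)).
      rewrite Hscal, Hsym, Hscal in H1.
      rewrite <- (sqrt_Rsqr (B_norm Z z)), <- sqrt_mult by (auto; try apply Rle_0_sqr; lra).
      apply sqrt_le_1_alt; unfold Rsqr.
      apply Rmult_le_compat_r with (r := B_norm Z z * B_norm Z z) in H1; [|nra].
      replace (/ B_norm Z z * (/ B_norm Z z * B z z) * (B_norm Z z * B_norm Z z))
        with (B z z) in H1 by (field; auto).
      exact H1. }
  assert (Hupper : forall z, sqrt (B z z) <= B_norm Z z).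
  { intros z; rewrite <- (sqrt_Rsqr (B_norm Z z)) by apply B_norm_nonneg.
    apply sqrt_le_1_alt, Hup. }
  assert (Hdef : forall x, B x x = 0 -> x = B_zero Z).
  { intros x H; apply B_norm_eq0.
    specialize (Hlower x); rewrite H, sqrt_0 in Hlower.
    pose proof (B_norm_nonneg Z x); nra. }
  assert (Hcomplete : complete_metric Z
            (fun x y => sqrt (B (B_add Z x (B_opp Z y)) (B_add Z x (B_opp Z y))))).
  { intros u Hu.
    destruct (B_complete Z u) as [l Hl].
    - intros eps Heps.
      destruct (Hu (sqrt c * eps)) as [n0 Hn0]; [nra|].
      exists n0; intros n m Hn Hm.
      apply Rmult_lt_reg_l with (sqrt c); auto.
      eapply Rle_lt_trans; [apply Hlower|auto].
    - exists l; intros eps Heps.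
      destruct (Hl eps Heps) as [n0 Hn0].
      exists n0; intros n Hn.
      eapply Rle_lt_trans; [apply Hupper|auto]. }
  exists (Build_HilbertSpace Z (B_zero Z) (B_add Z) (B_opp Z) (B_scal Z) B (B_vs Z)
            Hsym Hadd Hscal (fun x => proj1 (Hup x)) Hdef Hcomplete), (fun z => z).
  repeat split.
  - intros h; now exists h.
  - exists (sqrt c), 1; repeat split; try lra.
    + apply Hlower.
    + rewrite Rmult_1_l; apply Hupper.
Qed.

(** * Hilbert space geometry *)

Lemma H_inner_opp (H : HilbertSpace) (x y : H) :
  H_inner H (H_opp H x) y = - H_inner H x y.
Proof.
  destruct (H_vs H) as (_ & _ & Hz & Ho & _ & _ & _ & _).
  assert (H0 : H_inner H (H_zero H) y = 0).
  { pose proof (H_inner_add H (H_zero H) (H_zero H) y) as E; rewrite Hz in E; lra. }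
  pose proof (H_inner_add H x (H_opp H x) y) as E; rewrite Ho, H0 in E; lra.
Qed.

Lemma H_dist_sqr (H : HilbertSpace) (x y : H) :
  (H_dist H x y)² = H_inner H x x - 2 * H_inner H x y + H_inner H y y.
Proof.
  unfold H_dist, H_norm; rewrite Rsqr_sqrt by apply H_inner_pos.
  rewrite H_inner_add, H_inner_opp, !(H_inner_sym H _ (H_add H _ _)), !H_inner_add.
  rewrite !H_inner_opp, (H_inner_sym H y x); lra.
Qed.

Lemma H_quadrilateral (H : HilbertSpace) (p q r s : H) :
  (H_dist H p r)² + (H_dist H s q)² <=
  (H_dist H p q)² + (H_dist H q r)² + (H_dist H s r)² + (H_dist H p s)².
Proof.
  (* the difference of the two sides is [|p - q + r - s|^2] *)
  pose proof (H_inner_pos H (H_add H (H_add H p r) (H_opp H (H_add H q s)))) as E.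
  rewrite !H_dist_sqr.
  pose proof (H_dist_sqr H (H_add H p r) (H_add H q s)) as D.
  unfold H_dist, H_norm in D; rewrite Rsqr_sqrt in D by assumption.
  rewrite D, !H_inner_add, !(H_inner_sym H _ (H_add H _ _)), !H_inner_add in E.
  pose proof (H_inner_sym H r p); pose proof (H_inner_sym H s p).
  pose proof (H_inner_sym H q p); pose proof (H_inner_sym H r q).
  pose proof (H_inner_sym H s q); pose proof (H_inner_sym H s r).
  lra.
Qed.

(** * Attainment of the best Lipschitz constant *)

(** The infimum of the Lipschitz constants is itself one, since each constant dominates every
    difference quotient. Signs are reversed because [completeness] provides suprema. *)
Lemma lip_norm_exists {X Y : Type} (dX : X -> X -> R) (dY : Y -> Y -> R)
  (f : X -> Y) (C : R) :
  (forall x y, 0 <= dX x y) -> lipschitz_with dX dY f C -> exists L, lip_norm dX dY f L.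
Proof.
  intros HX HC.
  destruct (completeness (fun r => lipschitz_with dX dY f (- r))) as [l [Hub Hlub]].
  - exists 0; intros r [Hr _]; lra.
  - exists (- C); now rewrite Ropp_involutive.
  - exists (- l); split; [split|].
    + assert (l <= 0); [|lra].
      apply Hlub; intros r [Hr _]; lra.
    + intros x y; destruct (HX x y) as [Hxy|Hxy].
      * assert (l <= - (dY (f x) (f y) / dX x y)) as Hl.
        { apply Hlub; intros r [_ Hr]; specialize (Hr x y).
          apply Ropp_le_cancel; rewrite Ropp_involutive.
          apply Rmult_le_reg_r with (dX x y); auto.
          unfold Rdiv; rewrite Rmult_assoc, Rinv_l by lra; lra. }
        apply Rmult_le_compat_r with (r := dX x y) in Hl; [|lra].
        unfold Rdiv in Hl.
        rewrite Ropp_mult_distr_l_reverse, Rmult_assoc, Rinv_l in Hl by lra; lra.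
      (* At distance zero there is no quotient; the given constant [C] shows the images are at
         distance at most zero. *)
      * destruct HC as [_ HC]; specialize (HC x y); rewrite <- Hxy in *; lra.
    + intros L' HL'.
      assert (- L' <= l); [|lra].
      apply Hub; now rewrite Ropp_involutive.
Qed.

(** * From threshold embeddings to Hilbertian norms and back *)

Theorem theorem1p7 (Z : BanachSpace) :
  threshold_embeds_into_Hilbert Z <-> isomorphic_to_Hilbert Z.
Proof.
  split.
  - intros (H & K & HK & phi & Hphi).
    destruct (Hphi 1 Rlt_0_1) as (L & ((HL0 & HL) & _) & Hnd & Hthr).
    set (f := phi 1) in *.
    assert (Hdist : forall x y : H, 0 <= H_dist H x y) by (intros; apply sqrt_pos).
    assert (HK2 : 0 < (/ K)²) by (apply Rlt_0_sqr, Rinv_neq_0_compat; lra).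
    destruct (translation_invariant_kernel Z
      (fun x y => (H_dist H (f x) (f y) / L)²) ((/ K)²)) as (N & HN & HNc & HNq).
    + intros x y; split; [apply Rle_0_sqr|].
      destruct HL0 as [HL0| <-].
      * apply Rsqr_incr_1.
        -- apply Rmult_le_reg_r with L; auto.
           unfold Rdiv; rewrite Rmult_assoc, Rinv_l, Rmult_1_r by lra.
           rewrite Rmult_comm; apply HL.
        -- apply Rle_mult_inv_pos; auto.
        -- apply B_norm_nonneg.
      (* For [L = 0] the convention [/ 0 = 0] makes the kernel vanish. *)
      * unfold Rdiv; rewrite Rinv_0, Rmult_0_r, Rsqr_0; apply Rle_0_sqr.
    + intros x y Hxy.
      (* The pair [x], [y] at distance at least 1 triggers the non-degeneracy clause. *)
      assert (L > 0) by (apply Hnd; eauto).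
      apply Rsqr_incr_1.
      * specialize (Hthr x y Hxy).
        apply Rmult_le_reg_r with L; auto.
        unfold Rdiv in *; rewrite Rmult_assoc, Rinv_l by lra; lra.
      * left; apply Rinv_0_lt_compat; lra.
      * apply Rle_mult_inv_pos; auto.
    + intros p q r s; unfold Rdiv; rewrite !Rsqr_mult.
      pose proof (H_quadrilateral H (f p) (f q) (f r) (f s)).
      pose proof (Rle_0_sqr (/ L)); nra.
    + destruct (quadratic_form_exists Z N _ HN HNc HNq) as (Q & HQ & HQc & HQp).
      destruct (jordan_von_neumann Z Q HQ HQp) as (B & Bsym & Badd & Bscal & BQ).
      apply (inner_product_isomorphic Z B ((/ K)²)); auto; intros; rewrite BQ; auto.
  - intros (H & T & Tadd & Tscal & _ & c & C & Hc & HC & HT).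
    assert (Hd : forall x y, H_dist H (T x) (T y) = H_norm H (T (B_add Z x (B_opp Z y)))).
    { intros x y; unfold H_dist; f_equal.
      destruct (H_vs H) as (Ha & _ & Hz & Ho & _).
      replace (T x) with (H_add H (T (B_add Z x (B_opp Z y))) (T y)).
      - now rewrite <- Ha, Ho, Hz.
      - rewrite <- Tadd; f_equal.
        now rewrite B_add_right_comm, B_add_addK. }
    assert (HTd : forall x y, c * B_dist Z x y <= H_dist H (T x) (T y) <= C * B_dist Z x y)
      by (intros; rewrite Hd; apply HT).
    destruct (lip_norm_exists (B_dist Z) (H_dist H) T C) as [L HL].
    + intros; apply B_norm_nonneg.
    + split; [lra|intros; apply HTd].
    + assert (HLC : L <= C) by (apply HL; split; [lra|intros; apply HTd]).
      destruct HL as [[HL0 HL1] HL2].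
      (* With [K = C / c] and [L <= C], the required bound [L * tau / K] is at most [c * tau], which
         the lower estimate on [T] supplies. The same map [T] serves every scale. *)
      exists H, (C / c); split; [apply Rdiv_lt_0_compat; lra|].
      exists (fun _ => T); intros tau Htau; exists L; split; [repeat split; auto|split].
      (* A pair at positive distance [d] gives [c * d <= L * d], so [L >= c > 0]. *)
      * intros (x & y & Hxy); specialize (HTd x y); specialize (HL1 x y).
        apply Rlt_le_trans with c; auto.
        apply Rmult_le_reg_r with (B_dist Z x y); lra.
      * intros x y Hxy; specialize (HTd x y).
        apply Rle_ge, Rle_trans with (c * B_dist Z x y); [|apply HTd].
        apply Rle_trans with (c * tau); [|apply Rmult_le_compat_l; lra].
        replace (L * tau / (C / c)) with (c * tau * (L / C)) by (field; lra).
        rewrite <- (Rmult_1_r (c * tau)) at 2.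
        apply Rmult_le_compat_l; [nra|].
        apply Rmult_le_reg_r with C; auto.
        unfold Rdiv; rewrite Rmult_assoc, Rinv_l; lra.
Qed.
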